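(* For every $n\ge 3$ there exist distributions $G_1,\dots,G_n$ satisfying the standing assumptions for which no ordinal SCF solves program (OPT); that is, for these distributions there is an anonymous BIC SCF $f$ with $W(f)>W(g)$ for every ordinal, anonymous, BIC SCF $g$.
   Context: There are $n\ge 2$ agents $N=\{1,\dots,n\}$ choosing between a Reform $R$ and the Status quo $S$. Agent $i$ gets utility $0$ if $S$ is chosen and utility $v_i\in\mathbb{R}$ if $R$ is chosen. Values are independent random variables $\tilde v_1,\dots,\tilde v_n$, $\tilde v_i\sim G_i$ (Borel probability distributions on $\mathbb{R}$, $G_i(0)=\Pr(\tilde v_i\le 0)$). Standing assumptions: all $\tilde v_i$ have the same support $V$ with $0\notin V$; $\mathbb{E}|\tilde v_i|<\infty$; $p_i:=1-G_i(0)\in(0,1)$. An SCF is a Borel measurable $f:V^n\to[0,1]$ (probability of choosing $R$). $f$ is anonymous if $f(v)=f(\pi v)$ for every $v\in V^n$ and every permutation $\pi$ of $N$, where $\pi v=(v_{\pi(1)},\dots,v_{\pi(n)})$. $f$ is BIC if for every $i$ and all $v_i,v_i'\in V$: $v_i\,\mathbb{E}(f(v_i,\tilde v_{-i}))\ge v_i\,\mathbb{E}(f(v_i',\tilde v_{-i}))$ (expectation over $\tilde v_{-i}=(\tilde v_j)_{j\neq i}$). Expected welfare is $W(f)=\mathbb{E}\big(f(\tilde v)\sum_{i=1}^n\tilde v_i\big)$. Program (OPT): maximize $W(f)$ subject to $f$ being anonymous and BIC. For $v\in V^n$ let $\chi(v)=\{i\in N: v_i>0\}$. $f$ is ordinal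 if $f(v)=f(v')$ whenever $\chi(v)=\chi(v')$. *)

(* Defs.v *)
From HB Require Import structures.
From mathcomp Require Import all_boot all_order all_algebra all_fingroup.
From mathcomp Require Import all_classical all_reals all_analysis.
Set Implicit Arguments. Unset Strict Implicit. Unset Printing Implicit Defensive.
Import Order.TTheory GRing.Theory Num.Theory.
Import numFieldNormedType.Exports.
Local Open Scope classical_set_scope.
Local Open Scope ring_scope.

Section Model.
Context {R : realType} {n : nat} {d : measure_display} {Omega : measurableType d}.
Context (P : probability Omega R).

(** Mutual independence of the random variables (v i)_{i < n}: product rule
    for all families of Borel sets (taking B j = setT covers subfamilies). *)
Definition mutually_independent (v : 'I_n -> Omega -> R) : Prop :=
  forall B : 'I_n -> set R, (forall i, measurable (B i)) ->
    P (\bigcap_i (v i @^-1` B i)) = (\prod_(i < n) P (v i @^-1` B i))%E.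

(** Support of a Borel measure on R: points all of whose neighbourhoods have
    positive measure (the smallest closed set of full measure). *)
Definition msupport (mu : set R -> \bar R) : set R :=
  [set x | forall e : R, 0 < e -> (0 < mu (ball x e))%E].

(** Profiles are n-tuples of reals (with the product Borel sigma-algebra). *)
Definition profile (v : 'I_n -> Omega -> R) (w : Omega) : n.-tuple R :=
  [tuple v i w | i < n].

Definition upd (t : n.-tuple R) (i : 'I_n) (x : R) : n.-tuple R :=
  [tuple if j == i then x else tnth t j | j < n].

Definition Vn (V : set R) : set (n.-tuple R) := [set t | forall i, V (tnth t i)].

Definition chi (t : n.-tuple R) : {set 'I_n} := [set i | 0 < tnth t i].

Definition standing (v : 'I_n -> {RV P >-> R}) (V : set R) : Prop :=
  [/\ mutually_independent (fun i => v i),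
      (forall i, msupport (distribution P (v i)) = V),
      ~ V 0,
      (forall i, ('E_P[fun w => (`|v i w|)%R] < +oo)%E) &
      (forall i, (0 < 1 - cdf (v i) 0)%E /\ (1 - cdf (v i) 0 < 1)%E)].

(** An SCF: a Borel measurable map into [0,1] (defined on all of R^n; only
    its values on V^n matter). *)
Definition SCF (f : n.-tuple R -> R) : Prop :=
  measurable_fun [set: n.-tuple R] f /\ (forall t, 0 <= f t <= 1).

Definition anonymous (V : set R) (f : n.-tuple R -> R) : Prop :=
  forall t, Vn V t -> forall s : 'S_n, f t = f [tuple tnth t (s i) | i < n].

Definition ordinal_SCF (V : set R) (f : n.-tuple R -> R) : Prop :=
  forall t t', Vn V t -> Vn V t' -> chi t = chi t' -> f t = f t'.

Definition interim (v : 'I_n -> {RV P >-> R}) (f : n.-tuple R -> R)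
    (i : 'I_n) (x : R) : \bar R :=
  'E_P[fun w => f (upd (profile (fun j => v j) w) i x)].

Definition BIC (v : 'I_n -> {RV P >-> R}) (V : set R)
    (f : n.-tuple R -> R) : Prop :=
  forall i x x', V x -> V x' ->
    (x%:E * interim v f i x' <= x%:E * interim v f i x)%E.

Definition welfare (v : 'I_n -> {RV P >-> R}) (f : n.-tuple R -> R) : \bar R :=
  'E_P[fun w => (f (profile (fun j => v j) w) * \sum_(i < n) v i w)%R].

End Model.

(* Main.v *)
(** With [n] agents let agent [0] be special.  All values lie in
    [{- loss, eps, 1}] with [eps] small: when positive, the special agent's value
    is mostly [eps] while everybody else's is mostly [1].  The special agent's
    approval therefore matters least, and welfare would like [R] to win against a
    single negative value exactly when the special agent is the one objecting.
    An ordinal anonymous SCF cannot tell who objects, but [eps]-reports reveal it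
    statistically: with one negative value choose [R] iff the number of [eps]'s
    is even, with no negative value choose [R] unless all values are [1], and
    otherwise choose [S].  The parity is a product of signs, so interim
    expectations are sums of products, and BIC becomes one identity per agent
    ([incentive]), which determines the probabilities of a negative value.
    Finally [loss] is chosen so that the profiles with one negative value have
    total expected welfare [0]: then no ordinal anonymous SCF beats unanimity,
    whereas the rule above does. *)

Require Import Defs.
From HB Require Import structures.
From mathcomp Require Import all_boot all_order all_algebra all_fingroup.
From mathcomp Require Import all_classical all_reals all_analysis.
From mathcomp Require Import measurable_realfun measurable_fun_approximation.
From mathcomp Require Import ring lra.
Import Order.TTheory GRing.Theory Num.Theory.
Import numFieldNormedType.Exports.
Local Open Scope classical_set_scope.
Local Open Scope ring_scope.

(** * Finite product probability spaces *)

(** A separate name for the finite function space lets it carry the discrete sigma-algebra. The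
    labels 0, 1, 2 will stand for the values [- loss], [eps], 1. *)
Definition outcomes (n : nat) : Type := {ffun 'I_n -> 'I_3}.
HB.instance Definition _ n := Finite.on (outcomes n).
HB.instance Definition _ n :=
  isPointed.Build (outcomes n) ([ffun=> ord0] : {ffun 'I_n -> 'I_3}).
HB.instance Definition _ n := @isMeasurable.Build default_measure_display
  (outcomes n) discrete_measurable discrete_measurable0
  discrete_measurableC discrete_measurableU.

Lemma measurable_outcomes (n : nat) d (T : measurableType d)
  (h : outcomes n -> T) : measurable_fun setT h.
Proof. by []. Qed.

Section ProductMeasure.
Context {R : realType} {n : nat} (q : 'I_n -> 'I_3 -> R).
Hypothesis q_ge0 : forall i x, 0 <= q i x.
Hypothesis q_sum1 : forall i, \sum_x q i x = 1.

Definition weight (w : outcomes n) : R := \prod_i q i (w i).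

Lemma weight_ge0 w : 0 <= weight w.
Proof. by apply: prodr_ge0. Qed.

Definition mean (h : outcomes n -> R) : R := \sum_w weight w * h w.

(** Independence in product form: expanding the product of sums gives one term per outcome. *)
Lemma mean_prod (phi : 'I_n -> 'I_3 -> R) :
  mean (fun w => \prod_i phi i (w i)) =
  \prod_i \sum_x q i x * phi i x.
Proof.
rewrite bigA_distr_bigA; apply: eq_bigr => w _.
by rewrite /weight -big_split.
Qed.

(** As a finite combination of Dirac masses this is a measure by construction, and integrals against
    it reduce to finite sums. *)
Definition prod_prob : set (outcomes n) -> \bar R :=
  msum (fun k => mscale (NngNum (weight_ge0 (nth point (enum {: outcomes n}) k)))
                        \d_(nth point (enum {: outcomes n}) k))
       (size (enum {: outcomes n})).

HB.instance Definition _ := Measure.on prod_prob.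

Lemma sum_enum (F : outcomes n -> R) :
  \sum_(k < size (enum {: outcomes n})) F (nth point (enum {: outcomes n}) k) =
  \sum_w F w.
Proof. by rewrite -[RHS]big_enum (big_nth point) big_mkord. Qed.

Lemma prod_probE A : prod_prob A = (mean \1_A)%:E.
Proof.
rewrite /mean -sum_enum -sumEFin /prod_prob /msum/=; apply: eq_bigr => k _.
by rewrite /mscale/= diracE -EFinM indicE.
Qed.

Lemma mean1 : mean (fun=> 1) = 1.
Proof.
transitivity (mean (fun w => \prod_i (fun=> fun=> 1) i (w i))).
  by apply: eq_bigr => w _; rewrite big1.
rewrite (mean_prod (fun=> fun=> 1)) big1// => i _; rewrite -[RHS](q_sum1 i).
by apply: eq_bigr => x _; rewrite mulr1.
Qed.

Lemma prod_prob_setT : prod_prob setT = 1%:E.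
Proof. by rewrite prod_probE indicT mean1. Qed.

HB.instance Definition _ := @Measure_isProbability.Build _ _ R prod_prob prod_prob_setT.

Definition prod_probability : probability (outcomes n) R := prod_prob.

(** Nonnegative functions are integrated mass by mass; the general case recombines positive and
    negative parts. *)
Lemma expectationE (h : outcomes n -> R) : ('E_prod_probability[h] = (mean h)%:E)%E.
Proof.
have ge0 (u : outcomes n -> \bar R) : (forall w, 0 <= u w)%E ->
    (\int[prod_prob]_w u w = \sum_w (weight w)%:E * u w)%E.
  move=> u0; rewrite ge0_integral_measure_sum//.
  rewrite -[RHS]big_enum (big_nth point) big_mkord; apply: eq_bigr => k _.
  by rewrite ge0_integral_mscale//= integral_dirac//= diracT mul1e.
rewrite unlock integralE !ge0 //.
rewrite /mean -sumEFin.
under eq_bigr do rewrite funeposE -EFin_max -EFinM.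
under [X in (_ - X)%E]eq_bigr do rewrite funenegE -EFinN -EFin_max -EFinM.
rewrite !sumEFin -EFinB -sumrB; congr (_%:E); apply: eq_bigr => w _.
rewrite -mulrBr; congr (_ * _); rewrite /Order.max oppr_lt0.
by case: ltgtP => [||->]; rewrite ?subr0 ?sub0r ?opprK.
Qed.

End ProductMeasure.

(** * Independent values in a three-point set *)

Section MeanLinear.
Context {R : realType} {n : nat} (q : 'I_n -> 'I_3 -> R).
Implicit Types h g : outcomes n -> R.

Lemma meanD h g : mean q (fun w => h w + g w) = mean q h + mean q g.
Proof. by rewrite -big_split; apply: eq_bigr => w _; rewrite mulrDr. Qed.

Lemma meanZ c h : mean q (fun w => c * h w) = c * mean q h.
Proof. by rewrite mulr_sumr; apply: eq_bigr => w _; rewrite mulrCA. Qed.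

Lemma meanB h g : mean q (fun w => h w - g w) = mean q h - mean q g.
Proof. by rewrite -sumrB; apply: eq_bigr => w _; rewrite mulrBr. Qed.

Lemma mean_sum (I : finType) (P : pred I) (h : I -> outcomes n -> R) :
  mean q (fun w => \sum_(i | P i) h i w) = \sum_(i | P i) mean q (h i).
Proof. by rewrite exchange_big; apply: eq_bigr => w _; rewrite mulr_sumr. Qed.

Lemma le_mean h g : (forall i x, 0 <= q i x) -> (forall w, h w <= g w) ->
  mean q h <= mean q g.
Proof.
by move=> q0 hg; apply: ler_sum => w _; apply: ler_wpM2l; rewrite ?weight_ge0.
Qed.

Lemma eq_mean h g : h =1 g -> mean q h = mean q g.
Proof. by move=> hg; apply: eq_bigr => w _; rewrite hg. Qed.

End MeanLinear.

Section ThreeValues.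
Context {R : realType} {n : nat} (loss eps : R) (nu be al : 'I_n -> R).
Hypotheses (loss_gt0 : 0 < loss) (eps_gt0 : 0 < eps) (eps_lt1 : eps < 1).
Hypotheses (nu_gt0 : forall i, 0 < nu i) (be_gt0 : forall i, 0 < be i)
  (al_gt0 : forall i, 0 < al i) (sum1 : forall i, nu i + be i + al i = 1).

Definition value (x : 'I_3) : R := [:: - loss; eps; 1]`_x.
Definition law (i : 'I_n) (x : 'I_3) : R := [:: nu i; be i; al i]`_x.

Lemma law_gt0 i x : 0 < law i x.
Proof. by case: x => [[|[|[|//]]] ?]; rewrite /law/=. Qed.

Lemma law_ge0 i x : 0 <= law i x.
Proof. exact/ltW/law_gt0. Qed.

Lemma law_sum1 i : \sum_x law i x = 1.
Proof. by rewrite !big_ord_recl big_ord0 /law/= addr0 addrA. Qed.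

Definition prob : probability (outcomes n) R :=
  prod_probability law law_ge0 law_sum1.

Definition val_of (i : 'I_n) (w : outcomes n) : R := value (w i).
HB.instance Definition _ i :=
  isMeasurableFun.Build _ _ (outcomes n) R (val_of i) (measurable_outcomes _ _ _ (val_of i)).

Definition vals (i : 'I_n) : {RV prob >-> R} := val_of i.

Definition expect (i : 'I_n) (phi : R -> R) : R :=
  nu i * phi (- loss) + be i * phi eps + al i * phi 1.

(** Functions of product form, whose means factor over the agents. The rule [scf] is a linear
    combination of them. *)
Definition mono (phi : 'I_n -> R -> R) (t : n.-tuple R) : R :=
  \prod_i phi i (tnth t i).

Definition prof w := profile (fun j => val_of j) w.

Lemma lawE i (phi : R -> R) : \sum_x law i x * phi (value x) = expect i phi.
Proof. by rewrite !big_ord_recl big_ord0 /law /value/= addr0 addrA. Qed.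

Lemma mean_mono phi : mean law (fun w => mono phi (prof w)) = \prod_i expect i (phi i).
Proof.
rewrite -(eq_bigr _ (fun i _ => lawE i (phi i))).
rewrite -(mean_prod law (fun i x => phi i (value x))).
by apply: eq_mean => w; apply: eq_bigr => i _; rewrite tnth_mktuple.
Qed.

(** The overwritten coordinate contributes a constant factor, which [expect] preserves because the
    probabilities sum to 1. *)
Lemma mean_mono_upd phi i x :
  mean law (fun w => mono phi (upd (prof w) i x)) =
  phi i x * \prod_(k | k != i) expect k (phi k).
Proof.
pose psi k y := if k == i then phi i x else phi k y.
transitivity (mean law (fun w => mono psi (prof w))).
  apply: eq_mean => w; apply: eq_bigr => k _; rewrite !tnth_mktuple /psi.
  by case: eqVneq => [->|].
rewrite mean_mono (bigD1 i)//=; congr (_ * _).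
  by rewrite /expect /psi eqxx -!mulrDl sum1 mul1r.
by apply: eq_bigr => k /negPf ki; rewrite /expect /psi ki.
Qed.

(** Multiplying by the value of agent [i] alters only the [i]-th factor, so each summand keeps its
    product form. *)
Lemma mean_mono_sum phi :
  mean law (fun w => mono phi (prof w) * \sum_i val_of i w) =
  \sum_i expect i (fun y => phi i y * y) * \prod_(k | k != i) expect k (phi k).
Proof.
transitivity (\sum_i mean law (fun w => mono phi (prof w) * val_of i w)).
  by rewrite -mean_sum; apply: eq_mean => w; rewrite mulr_sumr.
apply: eq_bigr => i _.
pose psi k y := if k == i then phi i y * y else phi k y.
transitivity (mean law (fun w => mono psi (prof w))).
  apply: eq_mean => w; rewrite /mono (bigD1 i)//= [RHS](bigD1 i)//= mulrAC.
  congr (_ * _); first by rewrite /psi eqxx tnth_mktuple.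
  by apply: eq_bigr => k /negPf ki; rewrite /psi ki.
rewrite mean_mono (bigD1 i)//=; congr (_ * _); first by rewrite /psi eqxx.
by apply: eq_bigr => k /negPf ki; rewrite /expect /psi ki.
Qed.

Definition values : set R := [set x | [\/ x = - loss, x = eps | x = 1]].

Lemma value_values x : values (value x).
Proof.
by case: x => [[|[|[|//]]] ?]; [apply: Or31|apply: Or32|apply: Or33].
Qed.

Lemma mean_val i (phi : R -> R) :
  mean law (fun w => phi (val_of i w)) = expect i phi.
Proof.
pose psi k y := if k == i then phi y else 1.
transitivity (mean law (fun w => mono psi (prof w))).
  apply: eq_mean => w; rewrite /mono (bigD1 i)//= /psi eqxx tnth_mktuple.
  by rewrite big1 ?mulr1// => k /negPf ->.
rewrite mean_mono (bigD1 i)//= /psi eqxx big1 ?mulr1// => k /negPf ki.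
by rewrite /expect ki !mulr1.
Qed.

Lemma prob_val i (B : set R) : prob (val_of i @^-1` B) = (expect i \1_B)%:E.
Proof. by rewrite [LHS]prod_probE -mean_val; congr (_%:E). Qed.

Lemma independent_vals : mutually_independent prob (fun i => vals i).
Proof.
move=> B mB; rewrite (eq_bigr _ (fun i _ => prob_val i (B i))).
rewrite prodEFin [LHS]prod_probE; congr (_%:E).
(* The indicator of an intersection of coordinate events is itself of product form. *)
rewrite -(mean_mono (fun i => \1_(B i))); apply: eq_mean => w.
have [Bw|/existsNP[i Bw]] := pselect (forall i, B i (val_of i w)).
  rewrite indicE mem_set; last by move=> i _; exact: Bw.
  by symmetry; apply: big1 => i _; rewrite tnth_mktuple indicE mem_set//; exact: Bw.
rewrite indicE memNset; last by move=> /(_ i Logic.I).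
by rewrite /mono (bigD1 i)//= tnth_mktuple indicE memNset ?mul0r.
Qed.

Lemma support_vals i : msupport (distribution prob (vals i)) = values.
Proof.
apply/seteqP; split=> x.
  move=> /= xs; apply: contrapT => nVx.
  have [x1 x2 x3] : [/\ x <> - loss, x <> eps & x <> 1].
    by split=> xE; apply: nVx; [apply: Or31|apply: Or32|apply: Or33].
  (* The ball whose radius is the distance from [x] to the three values contains none of them, so it
     has measure 0. *)
  pose r := Num.min `|x - - loss| (Num.min `|x - eps| `|x - 1|).
  have r0 : 0 < r.
    by rewrite !lt_min !normr_gt0 !subr_eq0; apply/and3P; split; apply/eqP.
  have := xs r r0; rewrite [distribution _ _ _]prob_val lte_fin.
  rewrite /expect !indicE !memNset ?mulr0 ?addr0 ?ltxx//= /ball/= /r.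
  - by rewrite !lt_min ltxx !andbF.
  - by rewrite !lt_min ltxx !andbF.
  - by rewrite !lt_min ltxx.
move=> Vx r r0; rewrite [distribution _ _ _]prob_val lte_fin.
have bx : \1_(ball x r) x = 1 :> R by rewrite indicE mem_set//; exact: ballxx.
have ge0 c y : 0 < c -> 0 <= c * \1_(ball x r) y by move=> c0; rewrite indicE mulr_ge0 ?ler0n ?ltW.
have := (nu_gt0 i, be_gt0 i, al_gt0 i) => -[[n0 b0] a0].
rewrite /expect; case: Vx => Ex; have := bx; rewrite {2}Ex => ->; rewrite mulr1.
- by rewrite ltr_wpDr ?ltr_wpDr ?ge0.
- by rewrite ltr_wpDr ?ltr_wpDl ?ge0.
- by rewrite ltr_wpDl ?addr_ge0 ?ge0.
Qed.

Lemma standing_vals : standing vals values.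
Proof.
split.
- exact: independent_vals.
- exact: support_vals.
- case=> /eqP; rewrite eq_sym; last by rewrite oner_eq0.
    by rewrite oppr_eq0 gt_eqF.
  by rewrite gt_eqF.
- by move=> i; rewrite [('E_ _[_])%E]expectationE ltry.
- move=> i; rewrite /cdf [distribution _ _ _]prob_val.
  rewrite (_ : expect i _ = nu i); last first.
    rewrite /expect !indicE !mem_setE !in_itv/= oppr_le0 (ltW loss_gt0) !leNgt eps_gt0.
    by rewrite ltr01/= mulr1 !mulr0 !addr0.
  rewrite -EFinB !lte_fin; split; move: (sum1 i) (be_gt0 i) (al_gt0 i) (nu_gt0 i); lra.
Qed.

(** * The parity rule: range, measurability and anonymity *)

Definition at_value (c x : R) : R := (x == c)%:R.
Definition pos x := at_value 1 x + at_value eps x.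
Definition sgn x := at_value 1 x - at_value eps x.
Definition one_neg (phi : R -> R) (j k : 'I_n) : R -> R :=
  if k == j then at_value (- loss) else phi.

(** With exactly one negative coordinate, the sum over [j] is [1 + (-1)^N]
    where [N] is the number of coordinates equal to [eps]. *)
Definition scf (t : n.-tuple R) : R :=
  mono (fun=> pos) t - mono (fun=> at_value 1) t +
  2^-1 * \sum_j (mono (one_neg pos j) t + mono (one_neg sgn j) t).

Let NCeps : (- loss == eps) = false.
Proof. by apply/eqP => h; move: loss_gt0 eps_gt0; lra. Qed.
Let NC1 : (- loss == 1) = false.
Proof. by apply/eqP => h; move: loss_gt0 eps_lt1; lra. Qed.
Let eps1 : (eps == 1) = false.
Proof. by apply/eqP => h; move: loss_gt0 eps_lt1; lra. Qed.
Let epsNC : (eps == - loss) = false. Proof. by rewrite eq_sym. Qed.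
Let oneNC : (1 == - loss) = false. Proof. by rewrite eq_sym. Qed.
Let oneeps : (1 == eps) = false. Proof. by rewrite eq_sym. Qed.
Let vE := (NCeps, NC1, eps1, epsNC, oneNC, oneeps, eqxx).

(** An SCF is bounded on all real profiles, so the second case also covers numbers that are none of
    the three values. *)
Lemma pos_cases x :
  [/\ pos x = 1, at_value (- loss) x = 0, 0 <= at_value 1 x <= 1 & `|sgn x| = 1] \/
  [/\ pos x = 0, at_value 1 x = 0, sgn x = 0 & 0 <= at_value (- loss) x <= 1].
Proof.
rewrite /pos /sgn /at_value; have [->|x1] := eqVneq x 1.
  by left; rewrite !vE addr0 subr0 normr1 ler01 lexx.
have [->|xe] := eqVneq x eps.
  by left; rewrite !vE add0r sub0r normrN normr1 ler01 lexx.
by right; rewrite addr0 subr0; case: eqP; rewrite ?ler01 ?lexx.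
Qed.

Lemma mono_eq0 phi t j : phi j (tnth t j) = 0 -> mono phi t = 0.
Proof. by move=> h; rewrite /mono (bigD1 j)//= h mul0r. Qed.

Lemma one_neg_eq0 phi t j k :
  phi (tnth t k) = 0 -> j != k -> mono (one_neg phi j) t = 0.
Proof. by move=> h jk; apply: (@mono_eq0 _ _ k); rewrite /one_neg eq_sym (negPf jk). Qed.

(** If all coordinates are positive values, only the first difference survives. Otherwise some [j]
    has [pos] equal to 0 and only the [j]-th summand remains: half of [A + B] with
    [|B| <= A <= 1]. *)
Lemma scf_bounds t : 0 <= scf t <= 1.
Proof.
have [/forallP allpos|/forallPn[j /eqP posj]] :=
  boolP [forall k, pos (tnth t k) == 1].
  have posE k : pos (tnth t k) = 1 by exact/eqP.
  have neg0 k : at_value (- loss) (tnth t k) = 0.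
    by case: (pos_cases (tnth t k)); rewrite posE => -[]// /eqP; rewrite oner_eq0.
  have [m0 m1] : 0 <= mono (fun=> at_value 1) t /\ mono (fun=> at_value 1) t <= 1.
    split; [apply: prodr_ge0|apply: prodr_ile1] => k _;
    by rewrite /at_value; case: eqP; rewrite ?ler01 ?lexx.
  rewrite /scf big1 => [|j _]; last first.
    by rewrite !(@mono_eq0 _ _ j) ?addr0// /one_neg eqxx.
  have -> : mono (fun=> pos) t = 1 by apply: big1.
  by lra.
case: (pos_cases (tnth t j)) => [[]//|[p0 a0 s0 n01]].
rewrite /scf !(@mono_eq0 _ _ j)// subrr add0r (bigD1 j)//= big1 ?addr0; last first.
  by move=> k kj; rewrite !(@one_neg_eq0 _ _ _ j) ?addr0.
have A01 k : 0 <= one_neg pos j k (tnth t k) <= 1.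
  rewrite /one_neg; case: eqP => [->//|_].
  by case: (pos_cases (tnth t k)) => -[-> *]; rewrite ?ler01 ?lexx.
have A0 : 0 <= mono (one_neg pos j) t.
  by apply: prodr_ge0 => k _; case/andP: (A01 k).
have A1 : mono (one_neg pos j) t <= 1 by apply: prodr_ile1 => k _.
have : `|mono (one_neg sgn j) t| <= mono (one_neg pos j) t.
  rewrite /mono normr_prod; apply: ler_prod => k _; rewrite normr_ge0/= /one_neg.
  case: eqP => [->|_]; first by rewrite ger0_norm//; case/andP: n01.
  case: (pos_cases (tnth t k)) => -[-> ? E E']; first by rewrite E'.
  by rewrite E normr0.
by rewrite ler_norml; lra.
Qed.

Lemma measurable_at_value c : measurable_fun setT (at_value c).
Proof.
have -> : at_value c = \1_[set c].
  by apply/funext => x; rewrite /at_value indicE in_set1.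
exact: measurable_indic.
Qed.

Lemma measurable_mono phi : (forall i, measurable_fun setT (phi i)) ->
  measurable_fun setT (mono phi).
Proof.
move=> mphi; apply: measurable_prod => i _.
exact: measurableT_comp (mphi i) (measurable_tnth i).
Qed.

Lemma scf_SCF : SCF scf.
Proof.
split; last exact: scf_bounds.
have mpos : measurable_fun setT pos.
  by apply: measurable_funD; exact: measurable_at_value.
have msgn : measurable_fun setT sgn.
  by apply: measurable_funB; exact: measurable_at_value.
have mon phi j : measurable_fun setT phi -> measurable_fun setT (mono (one_neg phi j)).
  move=> mphi; apply: measurable_mono => k; rewrite /one_neg.
  by case: ifP => // _; exact: measurable_at_value.
apply: measurable_funD.
  by apply: measurable_funB; apply: measurable_mono => // _; exact: measurable_at_value.
apply: measurable_funM => //; apply: measurable_sum => j.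
by apply: measurable_funD; exact: mon.
Qed.

(** Permuting the coordinates moves the objector from [s j] to [j], which only reindexes the sum. *)
Lemma scf_anonymous : anonymous values scf.
Proof.
move=> t _ s.
have mE phi : mono (fun=> phi) [tuple tnth t (s i) | i < n] = mono (fun=> phi) t.
  rewrite [RHS](reindex_inj (@perm_inj _ s)).
  by apply: eq_bigr => k _; rewrite tnth_mktuple.
have oE phi j : mono (one_neg phi j) [tuple tnth t (s i) | i < n] =
    mono (one_neg phi (s j)) t.
  rewrite [RHS](reindex_inj (@perm_inj _ s)).
  by apply: eq_bigr => k _; rewrite tnth_mktuple /one_neg (inj_eq perm_inj).
rewrite /scf !mE; congr (_ + _ * _).
rewrite (reindex_inj (@perm_inj _ s)).
by apply: eq_bigr => j _; rewrite !oE.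
Qed.

(** * Interim expectations and incentive compatibility *)

Lemma expect_at_loss k : expect k (at_value (- loss)) = nu k.
Proof. by rewrite /expect /at_value !vE mulr1 !mulr0 !addr0. Qed.
Lemma expect_at1 k : expect k (at_value 1) = al k.
Proof. by rewrite /expect /at_value !vE mulr1 !mulr0 !add0r. Qed.
Lemma expect_pos k : expect k pos = be k + al k.
Proof. by rewrite /expect /pos /at_value !vE/=; lra. Qed.
Lemma expect_pos_id k : expect k (fun y => pos y * y) = eps * be k + al k.
Proof. by rewrite /expect /pos /at_value !vE/=; lra. Qed.
Lemma expect_sgn k : expect k sgn = al k - be k.
Proof. by rewrite /expect /sgn /at_value !vE/=; lra. Qed.
Lemma expect_one_neg phi j k :
  expect k (one_neg phi j k) = if k == j then nu k else expect k phi.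
Proof. by rewrite /one_neg; case: ifP => //; rewrite expect_at_loss. Qed.

(** For [j] other than [i] and [x] the means of [pos], this is the probability that [j] is the only
    objector among the agents other than [i]; with the means of [sgn], the same event is weighted by
    the parity sign. *)
Definition all_but_one (x : 'I_n -> R) (i j : 'I_n) : R :=
  \prod_(k | k != i) if k == j then nu k else x k.

Lemma mean_one_neg_upd phi i j x :
  mean law (fun w => mono (one_neg phi j) (upd (prof w) i x)) =
  if j == i then at_value (- loss) x * \prod_(k | k != i) expect k phi
  else phi x * all_but_one (expect ^~ phi) i j.
Proof.
rewrite mean_mono_upd /one_neg eq_sym; case: eqVneq => [->|ji].
  by congr (_ * _); apply: eq_bigr => k /negPf ->.
by congr (_ * _); apply: eq_bigr => k _; rewrite -expect_one_neg.
Qed.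

Lemma mean_scf_upd i x :
  mean law (fun w => scf (upd (prof w) i x)) =
  pos x * \prod_(k | k != i) expect k pos - at_value 1 x * \prod_(k | k != i) al k +
  2^-1 * (at_value (- loss) x *
    (\prod_(k | k != i) expect k pos + \prod_(k | k != i) expect k sgn) +
  (pos x * (\sum_(j | j != i) all_but_one (expect ^~ pos) i j) +
   sgn x * (\sum_(j | j != i) all_but_one (expect ^~ sgn) i j))).
Proof.
rewrite /scf meanD meanB meanZ mean_sum !mean_mono_upd (eq_bigr _ (fun k _ => expect_at1 k)).
rewrite [\sum_j mean _ _](bigD1 i)//= meanD !mean_one_neg_upd eqxx.
rewrite -mulrDr !mulr_sumr -big_split/=.
congr (_ + _ * (_ + _)); apply: eq_bigr => j /negPf ji.
by rewrite meanD !mean_one_neg_upd ji.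
Qed.

(** Equality of the interim expectations of [scf] at the reports [eps] and [1]. *)
Hypothesis incentive : forall i,
  \prod_(k | k != i) al k = \sum_(j | j != i) all_but_one (fun k => al k - be k) i j.

(** By [incentive] the reports [eps] and 1 are interim equivalent, so it remains to see that
    reporting [- loss] does not make the Reform likelier. *)
Lemma scf_BIC : BIC vals values scf.
Proof.
move=> i x x' Vx Vx'; rewrite /interim ![('E_ _[_])%E]expectationE -!EFinM lee_fin.
rewrite -![mean _ _]/(mean law (fun w => scf (upd (prof w) i _))) !mean_scf_upd.
have eE : (expect ^~ sgn) = fun k => al k - be k by apply/funext => k; rewrite expect_sgn.
rewrite !incentive eE.
have normd k : `|al k - be k| <= be k + al k.
  by rewrite ler_norml; move: (al_gt0 k) (be_gt0 k); lra.
set P := \prod_(k | k != i) expect k pos; set Q := \prod_(k | k != i) _.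
set A := \sum_(j | j != i) all_but_one (expect ^~ pos) i j.
set D := \sum_(j | j != i) _.
have QP : Q <= P.
  rewrite (le_trans (ler_norm _))// /Q normr_prod ler_prod// => k _.
  by rewrite normr_ge0 expect_sgn expect_pos normd.
have DA : D <= A.
  apply: ler_sum => j _; rewrite (le_trans (ler_norm _))// normr_prod ler_prod// => k _.
  rewrite normr_ge0/=; case: ifP => _; last by rewrite expect_pos normd.
  by rewrite ger0_norm// ltW.
pose F y := pos y * P - at_value 1 y * D +
  2^-1 * (at_value (- loss) y * (P + Q) + (pos y * A + sgn y * D)).
(* [F] is the interim probability of the Reform. The order follows from [Q <= P] and [D <= A],
   signed sums being dominated by unsigned ones. *)
have FN : F (- loss) = 2^-1 * (P + Q) by rewrite /F /pos /sgn /at_value !vE/=; lra.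
have FE : F eps = P + 2^-1 * (A - D) by rewrite /F /pos /sgn /at_value !vE/=; lra.
have F1 : F 1 = F eps by rewrite FE /F /pos /sgn /at_value !vE/=; lra.
have NE : F (- loss) <= F eps by rewrite FN FE; lra.
rewrite -!/(F _).
case: Vx => ->; [rewrite ler_nM2l ?oppr_lt0//|rewrite ler_pM2l//..];
  by case: Vx' => ->; rewrite ?F1 ?lexx.
Qed.

(** * Welfare comparison with ordinal rules *)

Lemma mean_one_neg phi j :
  mean law (fun w => mono (one_neg phi j) (prof w) * \sum_i val_of i w) =
  - (loss * (nu j * \prod_(k | k != j) expect k phi)) +
  \sum_(i | i != j) expect i (fun y => phi y * y) * all_but_one (expect ^~ phi) i j.
Proof.
rewrite mean_mono_sum (bigD1 j)//=; congr (_ + _).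
  rewrite /one_neg eqxx {1}/expect /at_value !vE/= !mul0r !mulr0 !addr0 mul1r.
  rewrite mulrN mulNr -mulrA mulrCA; congr (- (_ * (_ * _))).
  by apply: eq_bigr => k /negPf ->.
apply: eq_bigr => i /negPf ij; congr (_ * _); first by rewrite /one_neg ij.
by apply: eq_bigr => k _; rewrite -expect_one_neg.
Qed.

Hypothesis balanced : \sum_j
  mean law (fun w => mono (one_neg pos j) (prof w) * \sum_i val_of i w) = 0.
(** Welfare is nonpositive as soon as two values are negative. *)
Hypothesis two_objections : n%:R <= 2 + 2 * loss.

Lemma value_le1 x : value x <= 1.
Proof.
case: x => [[|[|[|//]]] ?]; rewrite /value//=; last exact: ltW.
by move: loss_gt0; lra.
Qed.

Lemma pos_value x : pos (value x) = (x != ord0)%:R.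
Proof.
by case: x => [[|[|[|//]]] ?]; rewrite /pos /at_value /value/= !vE ?addr0 ?add0r.
Qed.

Lemma at_loss_value x : at_value (- loss) (value x) = (x == ord0)%:R.
Proof. by case: x => [[|[|[|//]]] ?]; rewrite /at_value /value/= !vE. Qed.

Lemma value_gt0 x : (0 < value x) = (x != ord0).
Proof.
case: x => [[|[|[|//]]] ?]; rewrite /value/= ?ltr01 ?eps_gt0//.
by rewrite oppr_gt0 ltNge ltW.
Qed.

Lemma prof_values w : Vn values (prof w).
Proof. by move=> i; rewrite tnth_mktuple; exact: value_values. Qed.

(** A representative of the profiles with one negative value: an ordinal anonymous rule takes the
    same value at all of them. *)
Definition dissent (j : 'I_n) : n.-tuple R := [tuple if k == j then - loss else 1 | k < n].

Lemma dissent_values j : Vn values (dissent j).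
Proof.
by move=> k; rewrite tnth_mktuple; case: ifP => _; [apply: Or31|apply: Or33].
Qed.

Lemma anonymous_dissent g j0 j : anonymous values g -> g (dissent j) = g (dissent j0).
Proof.
move=> /(_ _ (dissent_values j) (tperm j j0)) ->; congr g.
apply: eq_from_tnth => k; rewrite !tnth_mktuple.
by rewrite -{2}(tpermR j j0) (inj_eq perm_inj).
Qed.

Lemma mono_pos_all (w : outcomes n) :
  (forall i, w i != ord0) -> mono (fun=> pos) (prof w) = 1.
Proof. by move=> w0; apply: big1 => i _; rewrite tnth_mktuple pos_value w0. Qed.

Lemma mono_pos_eq0 (w : outcomes n) j : w j = ord0 -> mono (fun=> pos) (prof w) = 0.
Proof. by move=> wj; apply: (@mono_eq0 _ _ j); rewrite tnth_mktuple pos_value wj. Qed.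

(** Pointwise bound by number of objectors: with none, total value is nonnegative and [g] is at most
    1; with one, [g] equals the constant [g (dissent j0)]; with more, total value is nonpositive. *)
Lemma ordinal_le g j0 (w : outcomes n) :
  SCF g -> ordinal_SCF values g -> anonymous values g ->
  g (prof w) * \sum_i val_of i w <=
  mono (fun=> pos) (prof w) * (\sum_i val_of i w) + g (dissent j0) *
  \sum_j (mono (one_neg pos j) (prof w) * \sum_i val_of i w).
Proof.
move=> [_ g01] og ag; rewrite -mulr_suml; set S := \sum_i val_of i w.
have [/forallP w0|/forallPn[j]] := boolP [forall i, w i != ord0].
  rewrite mono_pos_all// big1 => [|j _]; last first.
    apply: (@mono_eq0 _ _ j).
    by rewrite /one_neg eqxx tnth_mktuple at_loss_value (negPf (w0 j)).
  rewrite mul0r mulr0 addr0; apply: ler_wpM2r; last by case/andP: (g01 (prof w)).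
  by apply: sumr_ge0 => i _; rewrite ltW// value_gt0.
rewrite negbK => /eqP wj; rewrite (@mono_pos_eq0 _ j wj) mul0r add0r.
have other k : k != j -> mono (one_neg pos k) (prof w) = 0.
  move=> kj; apply: (@one_neg_eq0 _ _ _ j) => //.
  by rewrite tnth_mktuple pos_value wj.
rewrite (bigD1 j)//= [X in _ + X]big1 ?addr0; last by move=> k; exact: other.
have [/forall_inP w0|/forall_inPn[k kj]] := boolP [forall (k | k != j), w k != ord0].
  have -> : mono (one_neg pos j) (prof w) = 1.
    apply: big1 => k _; rewrite tnth_mktuple /one_neg.
    case: eqVneq => [->|kj]; first by rewrite at_loss_value wj.
    by rewrite pos_value w0.
  rewrite mul1r (og _ _ (prof_values w) (dissent_values j)) ?(@anonymous_dissent g j0 j)//.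
  apply/setP => k; rewrite !inE !tnth_mktuple value_gt0.
  case: (eqVneq k j) => [->|kj]; last by rewrite w0 // ltr01.
  by rewrite wj eqxx oppr_gt0 ltNge ltW.
rewrite negbK => /eqP wk.
have -> : mono (one_neg pos j) (prof w) = 0.
  apply: (@one_neg_eq0 _ _ _ k); last by rewrite eq_sym.
  by rewrite tnth_mktuple pos_value wk.
rewrite mul0r mulr0 mulr_ge0_le0//; first by case/andP: (g01 (prof w)).
have le1 i : val_of i w <= 1 := value_le1 (w i).
have [vj vk] : val_of j w = - loss /\ val_of k w = - loss by rewrite /val_of wj wk.
rewrite /S (bigD1 j)//= (bigD1 k)//= vj vk.
have : \sum_(i < n | (i != j) && (i != k)) val_of i w <=
    \sum_(i < n | (i != j) && (i != k)) 1 by apply: ler_sum.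
suff -> : \sum_(i < n | (i != j) && (i != k)) 1 = n%:R - 2 :> R by move: two_objections; lra.
have : \sum_(i < n) 1 = n%:R :> R by rewrite sumr_const card_ord.
by rewrite (bigD1 j)//= (bigD1 k)//= => <-; lra.
Qed.

Hypothesis gain : 2 * (n%:R * \prod_k al k) <
  - (loss * \sum_j nu j * \prod_(k | k != j) (al k - be k)).
Hypothesis al_be : forall i, eps * be i <= al i.

(** By [ordinal_le] and [balanced], [g] does no better than unanimity. Compared with unanimity,
    [scf] loses the all-ones profile, worth the mean [n * \prod_k al k], and gains half of the
    parity sum. The objectors' share of that sum is the right side of [gain], and the supporters'
    share is nonnegative. *)
Lemma scf_beats_ordinal g (j0 : 'I_n) :
  SCF g -> ordinal_SCF values g -> anonymous values g ->
  (welfare vals g < welfare vals scf)%E.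
Proof.
move=> sg og ag; rewrite /welfare ![('E_ _[_])%E]expectationE lte_fin.
apply: (@le_lt_trans _ _ (mean law (fun w => mono (fun=> pos) (prof w) * \sum_i val_of i w))).
  rewrite (le_trans (le_mean _ _ _ law_ge0 (fun w => ordinal_le _ j0 w sg og ag)))//.
  by rewrite meanD meanZ mean_sum balanced mulr0 addr0.
rewrite -[ltRHS]/(mean law (fun w => scf (prof w) * \sum_i val_of i w)).
under [ltRHS]eq_mean => w do rewrite /scf mulrDl mulrBl -mulrA mulr_suml
  (eq_bigr _ (fun j _ => mulrDl _ _ _)) big_split/=.
rewrite meanD meanB meanZ meanD !mean_sum balanced add0r -addrA ltrDl addrC subr_gt0.
have -> : mean law (fun w => mono (fun=> at_value 1) (prof w) * \sum_i val_of i w) =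
    n%:R * \prod_k al k.
  rewrite mean_mono_sum; transitivity (\sum_(i < n) \prod_k al k); last first.
    by rewrite sumr_const card_ord mulr_natl.
  apply: eq_bigr => i _; rewrite [RHS](bigD1 i)//=; congr (_ * _).
    by rewrite /expect /at_value !vE/=; lra.
  by apply: eq_bigr => k _; rewrite expect_at1.
have sgnE : expect ^~ sgn = fun k => al k - be k by apply/funext => k; rewrite expect_sgn.
rewrite (eq_bigr _ (fun j _ => mean_one_neg sgn j)) big_split/= sumrN -mulr_sumr.
under [X in loss * X]eq_bigr => j _ do rewrite (eq_bigr _ (fun k _ => expect_sgn k)).
rewrite (exchange_big_dep xpredT)//=.
(* With the supporter [i] outermost, [incentive] turns the inner sum over objectors into a product
   of the positive [al k]; [al_be] handles the remaining factor. *)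
have ge0 : 0 <= \sum_i \sum_(j | i != j)
    expect i (fun y => sgn y * y) * all_but_one (expect ^~ sgn) i j.
  apply: sumr_ge0 => i _; rewrite -mulr_sumr mulr_ge0//.
    by rewrite /expect /sgn /at_value !vE/=; move: (al_be i); lra.
  rewrite (eq_bigl (fun j => j != i)) => [|j]; last by rewrite eq_sym.
  by rewrite sgnE -incentive prodr_ge0// => k _; rewrite ltW.
by move: gain ge0; lra.
Qed.

End ThreeValues.

(** * Choice of the distributions *)

Section TwoKinds.
Context {F : fieldType} {m : nat}.
Implicit Types (i j : 'I_m.+2) (a b : F).

Definition special {T : Type} (a b : T) (i : 'I_m.+2) : T := if i == ord0 then a else b.

Lemma card_ne i : #|[pred k : 'I_m.+2 | k != i]| = m.+1.
Proof. by rewrite cardC1 card_ord. Qed.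

Lemma card_ne2 i j : i != j -> #|[pred k : 'I_m.+2 | (k != i) && (k != j)]| = m.
Proof.
move=> ij; apply: succn_inj; rewrite -[RHS](card_ne i).
rewrite [RHS](cardD1 j) inE eq_sym ij; congr _.+1.
by apply: eq_card => k; rewrite !inE andbC.
Qed.

Lemma prod_special a b i :
  \prod_(k | k != i) special a b k = special (b ^+ m.+1) (a * b ^+ m) i.
Proof.
rewrite /special; case: eqVneq => [->|i0].
  rewrite (eq_bigr (fun=> b)) => [|k /negPf ->//].
  by rewrite prodr_const card_ne.
rewrite (bigD1 ord0) 1?eq_sym//= (eq_bigr (fun=> b)) => [|k /andP[_ /negPf ->]//].
by rewrite prodr_const card_ne2.
Qed.

Lemma sum_special a b i :
  \sum_(k | k != i) special a b k = special (m.+1%:R * b) (a + m%:R * b) i.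
Proof.
rewrite /special; case: eqVneq => [->|i0].
  rewrite (eq_bigr (fun=> b)) => [|k /negPf ->//].
  by rewrite sumr_const card_ne mulr_natl.
rewrite (bigD1 ord0) 1?eq_sym//= (eq_bigr (fun=> b)) => [|k /andP[_ /negPf ->]//].
by rewrite sumr_const card_ne2// mulr_natl.
Qed.

Lemma prod_specialT a b : \prod_k special a b k = a * b ^+ m.+1.
Proof. by rewrite (bigD1 ord0)//= prod_special /special eqxx. Qed.

Lemma sum_specialT a b : \sum_k special a b k = a + m.+1%:R * b.
Proof. by rewrite (bigD1 ord0)//= sum_special /special eqxx. Qed.

End TwoKinds.

(** Restoring the missing factor [x j] leaves a product common to all [j], which makes [incentive]
    linear in the ratios [nu j / x j]. *)
Lemma all_but_oneE (R : realType) n (nu x : 'I_n -> R) i j : j != i -> x j != 0 ->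
  all_but_one nu x i j = nu j / x j * \prod_(k | k != i) x k.
Proof.
move=> ji xj; rewrite /all_but_one (bigD1 j)//= eqxx [in RHS](bigD1 j)//=.
rewrite mulrA divfK//; congr (_ * _).
by apply: eq_bigr => k /andP[_ /negPf ->].
Qed.

(** * Explicit parameters and verification of the hypotheses *)

Section Distributions.
Context {R : realType} {m : nat}.
Hypothesis m_gt0 : (0 < m)%N.
Local Notation n := m.+2.

(** The constant 16 gives [2 * n * eps = 1 / 8], small enough for [gain]. *)
Definition eps : R := (16 * n%:R)^-1.
(** Given a positive value, [al - be] becomes [ka] for an ordinary agent and [- ka] for the special
    one; [th] is the ordinary ratio [al / (al - be)]. *)
Definition ka : R := 1 - 2 * eps.
Definition th : R := (1 - eps) / ka.
(** [s1] and [s0] are the odds of a negative value for an ordinary agent and for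
    the special agent.  With [u = nu / (al - be)], that is [s1 / ka] and
    [- s0 / ka], [incentive] reads [(m + 1) u1 = th^(m + 1)] for the special agent
    and [u0 + m u1 = - (eps / ka) th^m] for the others. *)
Definition s1 : R := ka * th ^+ m.+1 / m.+1%:R.
Definition s0 : R := eps * th ^+ m + m%:R * s1.
Definition al : 'I_n -> R := special (eps / (1 + s0)) ((1 - eps) / (1 + s1)).
Definition be : 'I_n -> R := special ((1 - eps) / (1 + s0)) (eps / (1 + s1)).
Definition nu : 'I_n -> R := special (s0 / (1 + s0)) (s1 / (1 + s1)).
Definition M1 : R := 1 - eps + eps ^+ 2.
Definition M0 : R := eps + eps * (1 - eps).
(** The solution of [balanced]; [M0] and [M1] are the mean values given that the
    value is positive. *)
Definition loss : R :=
  (s0 * (m.+1%:R * M1) + m.+1%:R * (s1 * (M0 + m%:R * M1))) / (s0 + m.+1%:R * s1).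

Let m1 : 1 <= m%:R :> R. Proof. by rewrite ler1n. Qed.

Lemma eps_eq : eps * (m%:R + 2) = 1 / 16.
Proof.
rewrite /eps -[in X in X^-1](natr1 m.+1) -(natr1 m).
have : m%:R + 1 + 1 != 0 :> R by move: m1 => ?; apply/eqP; lra.
by move=> h; field; move: h; rewrite -addrA.
Qed.

Lemma eps_gt0 : 0 < eps.
Proof. by rewrite invr_gt0 mulr_gt0. Qed.

Lemma eps_small : eps <= 1 / 48.
Proof. by move: eps_eq eps_gt0 m1; nra. Qed.

Lemma ka_gt0 : 0 < ka.
Proof. by rewrite /ka; move: eps_small; lra. Qed.

Lemma kath : ka * th = 1 - eps.
Proof. by rewrite /th mulrC divfK// gt_eqF// ka_gt0. Qed.

Lemma th_gt0 : 0 < th.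
Proof. by rewrite /th divr_gt0 ?ka_gt0//; move: eps_small; lra. Qed.

Lemma s1_gt0 : 0 < s1.
Proof. by rewrite /s1 divr_gt0// mulr_gt0 ?ka_gt0// exprn_gt0// th_gt0. Qed.

Lemma s0_gt0 : 0 < s0.
Proof.
rewrite /s0 ltr_pwDl//; first by rewrite mulr_gt0 ?eps_gt0 ?exprn_gt0 ?th_gt0.
by rewrite mulr_ge0// ltW// s1_gt0.
Qed.

Let t1 : 0 < 1 + s1. Proof. by move: s1_gt0; lra. Qed.
Let t0 : 0 < 1 + s0. Proof. by move: s0_gt0; lra. Qed.
Let eps1m_gt0 : 0 < 1 - eps. Proof. by move: eps_small; lra. Qed.

Lemma special_gt0 (a b : R) i : 0 < a -> 0 < b -> 0 < special (m := m) a b i.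
Proof. by rewrite /special; case: ifP. Qed.

Lemma al_gt0 i : 0 < al i.
Proof. by apply: special_gt0; rewrite divr_gt0 ?eps_gt0. Qed.
Lemma be_gt0 i : 0 < be i.
Proof. by apply: special_gt0; rewrite divr_gt0 ?eps_gt0. Qed.
Lemma nu_gt0 i : 0 < nu i.
Proof. by apply: special_gt0; rewrite divr_gt0 ?s0_gt0 ?s1_gt0. Qed.

Lemma sum1 i : nu i + be i + al i = 1.
Proof.
rewrite /nu /be /al /special; case: ifP => _.
  by field; rewrite gt_eqF.
by field; rewrite gt_eqF.
Qed.

Lemma deE i : al i - be i = special (- ka / (1 + s0)) (ka / (1 + s1)) i.
Proof. by rewrite /al /be /special; case: ifP => _; rewrite /ka; lra. Qed.

Lemma de_neq0 i : al i - be i != 0.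
Proof.
rewrite deE /special.
by case: ifP => _; rewrite mulf_neq0 ?invr_neq0 ?oppr_eq0 ?gt_eqF ?ka_gt0.
Qed.

Lemma nu_de i : nu i / (al i - be i) = special (- s0 / ka) (s1 / ka) i.
Proof.
rewrite deE /nu /special.
by case: ifP => _; field; rewrite !gt_eqF ?ka_gt0.
Qed.

Lemma incentive i :
  \prod_(k | k != i) al k = \sum_(j | j != i) all_but_one nu (fun k => al k - be k) i j.
Proof.
rewrite [RHS](eq_bigr (fun j => special (- s0 / ka) (s1 / ka) j *
    \prod_(k | k != i) (al k - be k))); last first.
  by move=> j ji; rewrite all_but_oneE ?de_neq0// nu_de.
rewrite -mulr_suml sum_special (eq_bigr _ (fun k _ => deE k)) !prod_special /special.
have kN0 : ka != 0 by rewrite gt_eqF ?ka_gt0.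
have tN1 : 1 + s1 != 0 by rewrite gt_eqF.
have tN0 : 1 + s0 != 0 by rewrite gt_eqF.
have mN0 : m.+1%:R != 0 :> R by [].
case: ifP => _.
  (* Only the occurrence outside the denominators is unfolded, so that [1 + s1] cancels as an atom;
     likewise for [s0] below. *)
  rewrite !expr_div_n -kath exprMn {2}/s1.
  field.
  by rewrite expf_neq0// kN0 nat1r mN0.
rewrite !expr_div_n -kath exprMn {2}/s0.
field.
by rewrite expf_neq0// kN0 tN0.
Qed.

Lemma eps_lt1 : eps < 1. Proof. by move: eps1m_gt0; rewrite subr_gt0. Qed.

Let D : 0 < s0 + m.+1%:R * s1.
Proof. by apply: addr_gt0 s0_gt0 _; apply: mulr_gt0 => //; exact: s1_gt0. Qed.

(** [loss] is a weighted average of [(m + 1) * M1] and [M0 + m * M1], the expected supporters'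
    totals for the two kinds of objector; both are at least [m * M1]. *)
Lemma loss_ge : m%:R * M1 <= loss.
Proof.
rewrite /loss ler_pdivlMr// -[m.+1%:R]natr1.
have M1_ge0 : 0 <= M1 by rewrite /M1 addr_ge0 ?sqr_ge0 ?ltW.
have : 0 <= s0 * M1 by rewrite mulr_ge0// ltW// s0_gt0.
have M0_ge0 : 0 <= M0 by rewrite /M0 addr_ge0 ?mulr_ge0 ?ltW ?eps_gt0.
have : 0 <= (m%:R + 1) * (s1 * M0).
  apply: mulr_ge0; first by rewrite natr1.
  by apply: mulr_ge0 => //; apply: ltW; exact: s1_gt0.
by move=> ? ?; nra.
Qed.

Lemma M1_ge : 1 - eps <= M1.
Proof. by rewrite /M1 lerDl sqr_ge0. Qed.

Lemma two_objections : n%:R <= 2 + 2 * loss :> R.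
Proof.
rewrite -[n%:R]natr1 -[m.+1%:R]natr1; move: loss_ge M1_ge eps_small m1 => ? ? ? ?; nra.
Qed.

Lemma loss_gt0 : 0 < loss.
Proof. by apply: lt_le_trans loss_ge; rewrite mulr_gt0 ?ltr0n//; apply: lt_le_trans M1_ge. Qed.

Lemma al_be i : eps * be i <= al i.
Proof.
have := eps_gt0; have := eps_small => small pos.
rewrite /al /be /special; case: ifP => _; rewrite mulrA ler_pM2r ?invr_gt0//; nra.
Qed.

(** The probabilities of a positive value. *)
Definition ta : 'I_n -> R := special (1 + s0)^-1 (1 + s1)^-1.

Lemma ta_gt0 i : 0 < ta i.
Proof. by apply: special_gt0; rewrite invr_gt0. Qed.

(** Each summand is [\prod_k ta k] times the odds of [j] objecting times the supporters' conditional
    mean total minus [loss]. *)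
Lemma balanced : \sum_j
  mean (law nu be al) (fun w => mono (one_neg loss (pos eps) j) (prof loss eps w) *
                                \sum_i val_of loss eps i w) = 0.
Proof.
have epE k : expect loss eps nu be al k (pos eps) = ta k.
  rewrite expect_pos ?loss_gt0 ?eps_gt0 ?eps_lt1// /be /al /ta /special.
  by case: ifP => _; field; rewrite gt_eqF.
have emE k : expect loss eps nu be al k (fun y => pos eps y * y) = special M0 M1 k * ta k.
  rewrite expect_pos_id ?loss_gt0 ?eps_gt0 ?eps_lt1// /be /al /ta /special /M0 /M1.
  by case: ifP => _; field; rewrite gt_eqF.
rewrite (eq_bigr (fun j => (\prod_k ta k) *
  special (s0 * (m.+1%:R * M1 - loss)) (s1 * (M0 + m%:R * M1 - loss)) j)); last first.
  move=> j _; rewrite mean_one_neg ?loss_gt0 ?eps_gt0 ?eps_lt1//.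
  have nuE : nu j = special s0 s1 j * ta j by rewrite /nu /ta /special; case: ifP.
  rewrite (eq_bigr _ (fun k _ => epE k)).
  rewrite [X in _ + X](eq_bigr (fun i => special M0 M1 i * (special s0 s1 j * \prod_k ta k))).
    rewrite -mulr_suml sum_special nuE [\prod_k ta k](bigD1 j)//=.
    by rewrite /special; case: ifP => _; ring.
  move=> i ij; rewrite emE (_ : (expect loss eps nu be al)^~ (pos eps) = ta); last exact/funext.
  rewrite all_but_oneE; [|by rewrite eq_sym|by rewrite gt_eqF ?ta_gt0].
  rewrite nuE mulfK ?gt_eqF ?ta_gt0//.
  by rewrite [in RHS](bigD1 i)//=; ring.
rewrite -mulr_sumr sum_specialT /loss; apply/eqP; rewrite mulf_eq0; apply/orP; right.
apply/eqP; field.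
by rewrite nat1r gt_eqF.
Qed.

(** The special agent alone has [al - be] negative, so the product of these differences is negative
    while the sum of the ratios [nu / (al - be)] is positive: the right side is positive. The left
    side is small because the special agent has value 1 with probability at most [eps]. *)
Lemma gain : 2 * (n%:R * \prod_k al k) <
  - (loss * \sum_j nu j * \prod_(k | k != j) (al k - be k)).
Proof.
have kN0 : ka != 0 by rewrite gt_eqF ?ka_gt0.
have tN1 : 1 + s1 != 0 by rewrite gt_eqF.
have tN0 : 1 + s0 != 0 by rewrite gt_eqF.
have mN0 : m.+1%:R != 0 :> R by [].
rewrite [X in loss * X](eq_bigr (fun j => special (- s0 / ka) (s1 / ka) j *
    \prod_k (al k - be k))); last first.
  move=> j _; rewrite -nu_de [in RHS](bigD1 j)//=.
  by rewrite mulrA divfK ?de_neq0.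
rewrite -mulr_suml (eq_bigr _ (fun k _ => deE k)) !prod_specialT sum_specialT.
(* A positive factor common to both sides; after cancelling it the claim is
   [(1 - eps) / 8 < loss * ka * x]. *)
pose K := (1 + s0)^-1 * ((1 - eps) / (1 + s1)) ^+ m / (1 + s1).
have K_gt0 : 0 < K by rewrite !mulr_gt0 ?exprn_gt0 ?invr_gt0 ?divr_gt0.
rewrite [ltLHS](_ : _ = 2 * n%:R * eps * (1 - eps) * K); last first.
  by rewrite exprSr /K; ring.
rewrite [ltRHS](_ : _ = loss * ka * ((1 - eps) / m.+1%:R - eps) * K); last first.
  have -> : - s0 / ka + m.+1%:R * (s1 / ka) =
      th ^+ m * ((1 - eps) / m.+1%:R - eps) / ka.
    by rewrite /s0 /s1 exprS -kath; field; rewrite kN0 nat1r mN0.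
  rewrite /K !expr_div_n -kath !exprMn !exprS.
  by field; rewrite !expf_neq0// kN0 tN0 tN1 nat1r mN0.
rewrite ltr_pM2r//.
have -> : 2 * n%:R * eps = 1 / 8.
  by have := eps_eq; rewrite -[n%:R]natr1 -[m.+1%:R]natr1; lra.
set x := (1 - eps) / m.+1%:R - eps.
have xE : (m%:R + 1) * x = 1 - eps - eps * (m%:R + 1).
  by rewrite /x -[m.+1%:R]natr1; field; rewrite natr1.
(* The right side is exactly [1 - eps * (m + 2) = 15 / 16]. *)
have x_ge : 11 / 12 <= (m%:R + 1) * x.
  by rewrite xE; move: eps_eq eps_small eps_gt0; lra.
have x_ge0 : 0 <= x by rewrite -(pmulr_rge0 _ (ltr0Sn R m)) -natr1; move: x_ge; lra.
(* Here [m >= 1] enters as [m >= (m + 1) / 2], matching the factor [m + 1] in [x_ge]. *)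
have loss_half : (m%:R + 1) / 2 * (1 - eps) <= loss.
  apply: le_trans loss_ge; move: M1_ge m1 eps1m_gt0 => ? ? ?; nra.
have loss_x : (1 - eps) / 2 * (11 / 12) <= loss * x.
  apply: le_trans (ler_wpM2r x_ge0 loss_half).
  rewrite (_ : _ / 2 * _ * x = (1 - eps) / 2 * ((m%:R + 1) * x)); last by ring.
  by rewrite ler_wpM2l// divr_ge0// ltW.
have ka_ge : 23 / 24 <= ka by rewrite /ka; move: eps_small; lra.
by rewrite mulrAC; move: loss_x ka_ge eps1m_gt0 => ? ? ?; nra.
Qed.

End Distributions.

Theorem theorem2 (R : realType) (n : nat) : (3 <= n)%N ->
  exists (d : measure_display) (Omega : measurableType d)
         (P : probability Omega R) (v : 'I_n -> {RV P >-> R}) (V : set R),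
    standing v V /\
    exists f : n.-tuple R -> R,
      [/\ SCF f, anonymous V f, BIC v V f &
        forall g : n.-tuple R -> R,
          SCF g -> ordinal_SCF V g -> anonymous V g -> BIC v V g ->
          (welfare v g < welfare v f)%E].
Proof.
(* The number of agents becomes [m + 2] with [m] positive, agent [ord0] being the special one. *)
case: n => [|[|m]]//; rewrite !ltnS => m_gt0.
exists default_measure_display, (outcomes m.+2),
  (prob nu be al (nu_gt0 m_gt0) (be_gt0 m_gt0) (al_gt0 m_gt0) (sum1 m_gt0)),
  (vals (@loss R m) (@eps R m) nu be al
    (nu_gt0 m_gt0) (be_gt0 m_gt0) (al_gt0 m_gt0) (sum1 m_gt0)),
  (values (@loss R m) (@eps R m)).
split; first exact: standing_vals (loss_gt0 m_gt0) eps_gt0 _ _ _ _.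
exists (scf (@loss R m) (@eps R m)); split.
- exact: scf_SCF (loss_gt0 m_gt0) eps_gt0 (eps_lt1 m_gt0).
- exact: scf_anonymous.
- exact: scf_BIC (loss_gt0 m_gt0) eps_gt0 (eps_lt1 m_gt0) _ _ _ _ (incentive m_gt0).
- move=> g sg og ag _.
  exact: scf_beats_ordinal (loss_gt0 m_gt0) eps_gt0 (eps_lt1 m_gt0) _ _ _ _
    (incentive m_gt0)
    (balanced m_gt0) (two_objections m_gt0)
    (gain m_gt0) (al_be m_gt0) g ord0 sg og ag.
Qed.
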